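(* Let the target distribution be $\mu=(1-p)\mu_-+p\mu_+$, where $p\in(0,1)$, $\mu_-$ is a probability measure on $(-\infty,0)$ and $\mu_+$ is a probability measure on $(0,\infty)$. Let $\overline{\mu}_-(x)=\mu_-((-\infty,x))$ for $x\le 0$ and $\overline{\mu}_+(x)=\mu_+((x,\infty))$ for $x\ge 0$, and let $\mathcal{D}_\mu$ be the class of admissible drifts. If $$\int_{-\infty}^0\overline{\mu}_-^{\frac12}(x)\,dx=\infty\quad\text{and}\quad \int_0^\infty\overline{\mu}_+^{\frac12}(x)\,dx=\infty,$$ then $$\int_{\mathbb{R}}\big(E_0^{(b)}T_a\big)\,\mu(da)=\infty\quad\text{for all } b\in\mathcal{D}_\mu.$$
   Context: Fix $D>0$. For $\mu=(1-p)\mu_-+p\mu_+$ as in the claim define $A_-(\mu)=\inf\{x\in(-\infty,0):\mu_-((-\infty,x])>0\}\in[-\infty,0)$ and $A_+(\mu)=\sup\{x\in(0,\infty):\mu_+([x,\infty))>0\}\in(0,\infty]$. Admissible drifts: $\mathcal{D}_\mu$ is the class of drifts $b$ satisfying both of the following conditions. (1) $b$ is piecewise continuous and locally bounded on $(A_-(\mu),A_+(\mu))$, equals $+\infty$ on $(-\infty,A_-(\mu))$ and equals $-\infty$ on $(A_+(\mu),\infty)$; also, if $A_-(\mu)$ is an atom of $\mu$ then $b$ is locally bounded on $[A_-(\mu),A_+(\mu))$, and if $A_+(\mu)$ is an atom of $\mu$ then $b$ is locally bounded on $(A_-(\mu),A_+(\mu)]$. (2) (positive recurrence) $\int_{A_-(\mu)}^{A_+(\mu)}\exp\big(\frac2D\int_0^x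 b(y)\,dy\big)\,dx<\infty$. For $b\in\mathcal{D}_\mu$, $X(\cdot)$ is the diffusion process started at $0$ and generated by $\frac D2\frac{d^2}{dx^2}+b(x)\frac{d}{dx}$ on $(A_-(\mu),A_+(\mu))$; probabilities and expectations are denoted $P_0^{(b)},E_0^{(b)}$. If $A_-(\mu)>-\infty$ (respectively $A_+(\mu)<\infty$) and the diffusion can reach that endpoint, then the infinite drift beyond it means that the diffusion is reflected there (Neumann boundary condition). $T_a=\inf\{t\ge 0:X(t)=a\}$ is the hitting time of $a$, and $E_0^{(b)}T_a\in[0,\infty]$. *)

(* Defs.v *)
From HB Require Import structures.
From mathcomp Require Import all_boot all_order all_algebra.
From mathcomp Require Import all_classical all_reals all_analysis.

Set Implicit Arguments.
Unset Strict Implicit.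
Unset Printing Implicit Defensive.

Import Order.TTheory GRing.Theory Num.Theory.
Import numFieldTopology.Exports numFieldNormedType.Exports.

Local Open Scope classical_set_scope.
Local Open Scope ring_scope.

Section Endpoints.
Context {R : realType}.

Definition A_minus (mum : probability (measurableTypeR R) R) : \bar R :=
  ereal_inf [set x%:E | x in [set x : R | x < 0 /\ (0 < mum `]-oo, x]%classic)%E]].

Definition A_plus (mup : probability (measurableTypeR R) R) : \bar R :=
  ereal_sup [set x%:E | x in [set x : R | 0 < x /\ (0 < mup `[x, +oo[%classic)%E]].

(* Real points of the intervals with (possibly infinite) endpoints l and r. *)
Definition open_span (l r : \bar R) : set R :=
  [set x | (l < x%:E)%E /\ (x%:E < r)%E].

Definition closed_span (l r : \bar R) : set R :=
  [set x | (l <= x%:E)%E /\ (x%:E <= r)%E].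

End Endpoints.

Section Drifts.
Context {R : realType}.
Implicit Types (b : R -> \bar R) (S : set R).

(* Discontinuities may accumulate only outside S; one-sided limits are not
   required to exist. *)
Definition piecewise_continuous S b :=
  forall c d : R, `[c, d] `<=` S ->
    finite_set [set x : R | x \in `[c, d] /\ ~ {for x, continuous b}].

Definition locally_bounded S b :=
  forall x, S x -> exists M : R, \forall y \near x, S y -> (`|b y| <= M%:E)%E.

(* The oriented integral of b from 0 to x. *)
Definition drift_integral b (x : R) : R :=
  if 0 <= x then \int[@lebesgue_measure R]_(y in `[0, x]) fine (b y)
  else - \int[@lebesgue_measure R]_(y in `[x, 0]) fine (b y).

(* Density with respect to Lebesgue measure of the (unnormalised) invariant
   measure of D/2 d^2/dx^2 + b d/dx. *)
Definition speed_density (D : R) b (x : R) : R :=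
  expR (2 / D * drift_integral b x).

Record admissible (D : R) (mu mum mup : probability (measurableTypeR R) R) b
    : Prop := {
  adm_pcont : piecewise_continuous (open_span (A_minus mum) (A_plus mup)) b ;
  adm_bounded : locally_bounded (open_span (A_minus mum) (A_plus mup)) b ;
  adm_left : forall x : R, (x%:E < A_minus mum)%E -> b x = +oo%E ;
  adm_right : forall x : R, (A_plus mup < x%:E)%E -> b x = -oo%E ;
  adm_left_atom :
    (exists a : R, A_minus mum = a%:E /\ (0 < mu [set a])%E) ->
    locally_bounded
      [set x | (A_minus mum <= x%:E)%E /\ (x%:E < A_plus mup)%E] b ;
  adm_right_atom :
    (exists a : R, A_plus mup = a%:E /\ (0 < mu [set a])%E) ->
    locally_bounded
      [set x | (A_minus mum < x%:E)%E /\ (x%:E <= A_plus mup)%E] b ;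
  adm_recurrent :
    (\int[@lebesgue_measure R]_(x in open_span (A_minus mum) (A_plus mup))
       (speed_density D b x)%:E < +oo)%E
}.

End Drifts.

Section Diffusions.
Context {R : realType}.

(* [generator D b l r f g]: f is in the domain of Feller's generator
   L = D/2 d^2/dx^2 + b d/dx on (l, r), and L f = g.  Since f and g are
   continuous, f'' jumps where b does, so the equation is imposed at the
   continuity points of b.
   The reflecting condition is written with the flux e^{(2/D) int_0^x b} f'(x),
   i.e. the derivative of f with respect to the scale function; it reads
   f' = 0 at the endpoint when b is bounded near that endpoint, and still makes
   sense when b is not.  When the speed density is integrable, the condition
   holds automatically at a finite endpoint that the diffusion cannot reach,
   and an infinite endpoint cannot be reached. *)
Record generator (D : R) (b : R -> \bar R) (l r : \bar R) (f g : R -> R)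
    : Prop := {
  gen_bounded : exists M : R,
    forall x, closed_span l r x -> `|f x| <= M /\ `|g x| <= M ;
  gen_cont : {within closed_span l r, continuous f} ;
  gen_cont_image : {within closed_span l r, continuous g} ;
  gen_derivable : forall x, open_span l r x -> derivable f x 1 ;
  gen_C1 : forall x, open_span l r x -> {for x, continuous (derive1 f)} ;
  gen_equation : forall x, open_span l r x -> {for x, continuous b} ->
    derivable (derive1 f) x 1 /\
    D / 2 * derive1 (derive1 f) x + fine (b x) * derive1 f x = g x ;
  gen_reflect_left : forall a : R, l = a%:E ->
    (speed_density D b x * derive1 f x) @[x --> a^'+] --> (0 : R) ;
  gen_reflect_right : forall a : R, r = a%:E ->
    (speed_density D b x * derive1 f x) @[x --> a^'-] --> (0 : R)
}.

Context {d : measure_display} {Omega : measurableType d}.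
Variable P : probability Omega R.

(* Processes are indexed by R; only the times t >= 0 matter. *)
Implicit Types X M : R -> Omega -> measurableTypeR R.

Definition natural_filtration X (t : R) : set (set Omega) :=
  <<s \bigcup_(s in `[0, t]) preimage_set_system setT (X s) measurable >>.

Record martingale (F : R -> set (set Omega)) M : Prop := {
  mart_adapted : forall t : R, 0 <= t ->
    forall B : set (measurableTypeR R), measurable B -> F t (M t @^-1` B) ;
  mart_integrable : forall t : R, 0 <= t -> P.-integrable setT (EFin \o M t) ;
  mart_eq : forall s t : R, 0 <= s -> s <= t -> forall A, F s A ->
    (\int[P]_(w in A) (M t w)%:E = \int[P]_(w in A) (M s w)%:E)%E
}.

(* X is a diffusion on (l, r) started at x0, generated by
   D/2 d^2/dx^2 + b d/dx and reflected at the finite endpoints it can reach: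
   a solution of the martingale problem for [generator], which determines the
   law of X. *)
Record diffusion (D : R) (b : R -> \bar R) (l r : \bar R) (x0 : R) X
    : Prop := {
  diff_meas : forall t : R, 0 <= t -> measurable_fun setT (X t) ;
  diff_cont : forall w,
    {within `[0, +oo[, continuous (fun t : R => X t w : R)} ;
  diff_state : forall (t : R) w, 0 <= t -> closed_span l r (X t w) ;
  diff_start : {ae P, forall w, X 0 w = x0} ;
  diff_mart : forall f g, generator D b l r f g ->
    martingale (natural_filtration X)
      (fun t w =>
         f (X t w) - \int[@lebesgue_measure R]_(s in `[0, t]) g (X s w))
}.

Definition hitting_time X (a : R) (w : Omega) : \bar R :=
  ereal_inf [set t%:E | t in [set t : R | 0 <= t /\ X t w = a]].

Definition mean_hitting_time X (a : R) : \bar R :=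
  (\int[P]_(w in setT) hitting_time X a w)%E.

End Diffusions.

(* Main.v *)
Require Import Defs.
From HB Require Import structures.
From mathcomp Require Import all_boot all_order all_algebra.
From mathcomp Require Import all_classical all_reals all_analysis.
From mathcomp Require Import measurable_realfun.
From mathcomp Require Import ring lra.

Import Order.TTheory GRing.Theory Num.Theory.
Import numFieldTopology.Exports numFieldNormedType.Exports.

Local Open Scope classical_set_scope.
Local Open Scope ring_scope.

(** Write S(a) for the integral of 1/e over [0, a], where e = exp((2/D) int_0^x b)
    is the speed density. For a > 0 the mean hitting time of a is

      (2/D) int_0^a (1/e(y)) int_(-oo)^y e(z) dz dy >= k S(a),

    where k = (2/D) int_(-oo)^0 e(z) dz does not depend on a; any such k will do.
    Averaging over the target and exchanging the integrals,

      int S(a) mu(da) = int_0^oo mu(]x, oo[) / e(x) dx,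

    and positive recurrence, that is the integrability of e, makes this infinite:
    the square root of the tail is at most e + tail / e, and it has an infinite
    integral ([integral_scale_pinfty]). The heavy tails also exclude finite
    endpoints ([A_plus_pinfty], [A_minus_ninfty]), so the diffusion lives on the
    whole line and has no boundary condition.

    The bound E T_a >= k S(a) is obtained from the martingale problem. A function f
    with f' = 1/e on [0, a], tapered to be constant outside [-1, a + 1], is bounded
    and in the domain of the generator, and the taper can be chosen so that its
    image under the generator is continuous and at most some gam independent of a
    ([test_generator], [test_image_le]). Heuristically f(a) - f(0) = E f(X_T) - f(0)
    <= gam E T with T = T_a, which is the bound with k = 1/gam since f(a) - f(0) =
    S(a). To justify it, the process is observed on a finite grid and stopped when
    it is first seen above some c < a ([grid_stopping]); a path that visits a is
    seen above c on every fine enough grid shortly after ([occupation_hit]), and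
    Fatou's lemma passes to the limit ([mean_hitting_time_ge]). *)

(** * The oriented integral as an antiderivative *)

Section antiderivative.
Context {R : realType}.
Notation leb := (@lebesgue_measure R).
Implicit Types (b : R -> \bar R) (h : R -> R).

(** Stated on symmetric segments and through [fine], so that it covers both
    drifts and real functions composed with [EFin]. *)
Definition locally_summable b := forall c : R,
  leb.-integrable `[- c, c] (fun x => (fine (b x))%:E).

Lemma locally_summable_itv b (x y : R) : locally_summable b ->
  leb.-integrable `[x, y] (fun x => (fine (b x))%:E).
Proof.
move=> hb; apply: integrableS (hb (Num.max `|x| `|y|)) => //.
move=> z /=; rewrite !in_itv/= => /andP[xz zy].
apply/andP; split.
- by rewrite lerNl le_max ler_normr lerN2 xz orbT.
- by rewrite le_max (le_trans zy (ler_norm _)) orbT.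
Qed.

(** Moving the base point to some m below both 0 and x removes the case
    distinction on the sign of x, after which the fundamental theorem of calculus
    for integrals over [m, x] applies. *)
Lemma drift_integralE b (m x : R) : locally_summable b -> m <= 0 -> m <= x ->
  drift_integral b x = \int[leb]_(y in `[m, x]) fine (b y) -
                       \int[leb]_(y in `[m, 0]) fine (b y).
Proof.
move=> hb m0 mx; rewrite /drift_integral; case: ifPn => [x0|].
- rewrite Rintegral_itvB ?bnd_simp//; last exact: locally_summable_itv.
  by rewrite Rintegral_itv_obnd_cbnd//;
    apply: integrableS (locally_summable_itv b 0 x hb) => //; exact: subset_itv_oc_cc.
- rewrite -ltNge => /ltW x0; rewrite -[RHS]opprB; congr (- _).
  rewrite Rintegral_itvB ?bnd_simp//; last exact: locally_summable_itv.
  by rewrite Rintegral_itv_obnd_cbnd//;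
    apply: integrableS (locally_summable_itv b x 0 hb) => //; exact: subset_itv_oc_cc.
Qed.

Lemma drift_integralB b (x y : R) : locally_summable b -> x <= y ->
  drift_integral b y - drift_integral b x = \int[leb]_(z in `[x, y]) fine (b z).
Proof.
move=> hb xy; pose m := Num.min 0 x.
have m0 : m <= 0 by rewrite ge_min lexx.
have mx : m <= x by rewrite ge_min lexx orbT.
rewrite (drift_integralE b m y)// ?(le_trans mx)// (drift_integralE b m x)//.
rewrite opprB addrA subrK Rintegral_itvB ?bnd_simp//; last exact: locally_summable_itv.
by rewrite Rintegral_itv_obnd_cbnd//;
  apply: integrableS (locally_summable_itv b x y hb) => //; exact: subset_itv_oc_cc.
Qed.

(** Differentiability only needs continuity at the point itself, which is what
    makes the drift integral usable for a drift that jumps. *)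
Lemma drift_integral_derive b (x : R) : locally_summable b ->
  {for x, continuous (fun y => fine (b y))} ->
  derivable (drift_integral b) x 1 /\ derive1 (drift_integral b) x = fine (b x).
Proof.
move=> hb cx; pose m := Num.min 0 x - 1.
have m0 : m < 0 by rewrite ltrBlDr add0r gt_min ltr01.
have mx : m < x by rewrite ltrBlDr gt_min ltrDl ltr01 orbT.
have [||+ +] := @continuous_FTC1 R _ (BLeft m) x (x + 1) _ (locally_summable_itv b m (x+1) hb) _ cx.
- by rewrite ltrDl.
- by rewrite lte_fin.
set F := fun _ => _ => dF F'.
have FE : {near x, drift_integral b =1 F \- cst (\int[leb]_(y in `[m, 0]) fine (b y))}.
  near=> z; apply: drift_integralE => //; first exact: ltW.
  by apply: ltW; near: z; exact: lt_nbhsr.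
(* Forgetting that F is an integral keeps unification from unfolding it. *)
move: (\int[leb]_(y in `[m, 0]) fine (b y)) FE dF F' => c; move: F => F FE dF F'.
split.
  apply: (@near_eq_derivable _ _ _ (F \- cst c)).
    by apply: filterS FE => z ->.
  by apply: derivableB => //; exact: derivable_cst.
rewrite -F' !derive1E (@near_eq_derive _ _ _ _ _ x 1 FE) deriveB//.
by rewrite derive_cst subr0.
Unshelve. all: by end_near. Qed.

Lemma drift_integral_continuous b : locally_summable b ->
  continuous (drift_integral b).
Proof.
move=> hb x; pose m := Num.min 0 x - 1.
have m0 : m < 0 by rewrite ltrBlDr add0r gt_min ltr01.
have mx : m < x by rewrite ltrBlDr gt_min ltrDl ltr01 orbT.
have xx1 : x < x + 1 by rewrite ltrDl.
have mx1 : m <= x + 1 by rewrite ltW// (lt_trans mx).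
have := parameterized_integral_continuous mx1 (locally_summable_itv b m (x+1) hb).
move=> /(continuous_within_itvP _ (lt_trans mx xx1))[/(_ x)].
rewrite in_itv/= mx xx1 => /(_ erefl) cx _ _.
have FE : \forall z \near x, parameterized_integral leb m z (fun y => fine (b y)) -
    \int[leb]_(y in `[m, 0]) fine (b y) = drift_integral b z.
  near=> z; rewrite (drift_integralE b m z)//; first exact: ltW.
  by apply: ltW; near: z; exact: lt_nbhsr.
rewrite /continuous_at (drift_integralE b m x)//; try exact: ltW.
apply: cvg_trans; first exact: near_eq_cvg FE.
by apply: cvgB => //; exact: cvg_cst.
Unshelve. all: by end_near. Qed.

Lemma continuous_locally_summable h : continuous h -> locally_summable (EFin \o h).
Proof.
move=> ch c; apply: continuous_compact_integrable; first exact: segment_compact.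
exact: continuous_subspaceT.
Qed.

End antiderivative.

(** * Heavy tails leave no finite endpoint *)

Section endpoints.
Context {R : realType}.
Notation leb := (@lebesgue_measure R).
Implicit Types m : probability (measurableTypeR R) R.

Lemma measurable_upper_tail m : measurable_fun setT ((fun x => m `]x, +oo[%classic) : R -> \bar R).
Proof.
rewrite (_ : ((fun _ => _) : R -> \bar R) = EFin \o (fun x : R => fine (m `]x, +oo[%classic))); last first.
  by apply/funext => x /=; rewrite fineK// fin_num_measure.
apply/measurable_EFinP; apply: nonincreasing_measurable => // x y xy.
rewrite fine_le ?fin_num_measure// le_measure ?inE//.
by apply: subset_itvr; rewrite bnd_simp.
Qed.

Lemma measurable_lower_tail m : measurable_fun setT ((fun x => m `]-oo, x[%classic) : R -> \bar R).
Proof.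
rewrite (_ : ((fun _ => _) : R -> \bar R) = EFin \o (fun x : R => fine (m `]-oo, x[%classic))); last first.
  by apply/funext => x /=; rewrite fineK// fin_num_measure.
apply/measurable_EFinP; apply: nondecreasing_measurable => // x y xy.
rewrite fine_le ?fin_num_measure// le_measure ?inE//.
by apply: subset_itvl; rewrite bnd_simp.
Qed.

Lemma integral_sqrt_lty (S I : set R) (F : R -> \bar R) :
  measurable S -> measurable I -> (leb I < +oo)%E ->
  measurable_fun setT F -> (forall x, 0 <= F x <= 1)%E ->
  (forall x, S x -> ~ I x -> F x = 0%E) ->
  (\int[leb]_(x in S) F x `^ (2^-1)%R < +oo)%E.
Proof.
move=> mS mI Ifin mF F01 F0.
have le1 : (\int[leb]_(x in S) F x `^ (2^-1)%R <= \int[leb]_(x in S) (\1_I x)%:E)%E.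
  apply: ge0_le_integral => //.
  - by move=> x _; exact: poweR_ge0.
  - apply: (@measurableT_comp _ _ _ _ _ _ (fun x => x `^ 2^-1)%E); first exact: measurable_poweR.
    exact: measurable_funTS.
  - by apply/measurable_EFinP; exact: measurable_funTS.
  - move=> x Sx; rewrite indicE; case: (asboolP (I x)) => Ix.
      rewrite mem_set//=; have /andP[Fx0 Fx1] := F01 x.
      have /gt0_ler_poweR : 0 <= 2^-1 :> R by rewrite invr_ge0.
      move=> /(_ (F x) 1%E); rewrite poweR1r; apply => //.
      - by rewrite in_itv/= Fx0 leey.
      - by rewrite in_itv/= lee01 leey.
    by rewrite memNset//= F0// poweR0r// invr_eq0 pnatr_eq0.
apply: le_lt_trans le1 _; rewrite integral_indic//.
by apply: le_lt_trans Ifin; apply: le_measure; rewrite ?inE//; exact: measurableI.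
Qed.

(** Beyond a finite endpoint the tail of the law vanishes, so the integral of its
    square root would reduce to one of a bounded function over a segment. *)
Lemma A_plus_pinfty m :
  (\int[leb]_(x in `[0%R, +oo[) (m `]x, +oo[%classic) `^ (2^-1)%R = +oo)%E ->
  A_plus m = +oo%E.
Proof.
move=> tail; apply/eqP; rewrite -leye_eq leNgt; apply/negP => Ay.
suff : (\int[leb]_(x in `[0%R, +oo[) (m `]x, +oo[%classic) `^ (2^-1)%R < +oo)%E.
  by rewrite tail ltxx.
have [M AM] : exists M : R, (A_plus m <= M%:E)%E.
  by case: (A_plus m) Ay => [r _|//|_]; [exists r|exists 0; rewrite leNye].
apply: (@integral_sqrt_lty _ `[0, Num.max 0 M]) => //.
- by rewrite lebesgue_measure_itv/=; case: ifP => _; rewrite ltry.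
- exact: measurable_upper_tail.
- by move=> x; rewrite measure_ge0 probability_le1.
move=> x /=; rewrite !in_itv/= andbT => x0 /negP.
rewrite x0/= le_max negb_or -!ltNge => /andP[{}x0 Mx].
apply/eqP; rewrite eq_le measure_ge0 andbT leNgt; apply/negP => m0.
have : (x%:E <= A_plus m)%E.
  apply: ereal_sup_ubound; exists x => //; split => //.
  by apply: lt_le_trans m0 _; apply: le_measure; rewrite ?inE//; apply: subset_itvr; rewrite bnd_simp.
by rewrite leNgt (le_lt_trans AM)// lte_fin.
Qed.

Lemma A_minus_ninfty m :
  (\int[leb]_(x in `]-oo, 0%R]) (m `]-oo, x[%classic) `^ (2^-1)%R = +oo)%E ->
  A_minus m = -oo%E.
Proof.
move=> tail; apply/eqP; rewrite -leeNy_eq leNgt; apply/negP => Ay.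
suff : (\int[leb]_(x in `]-oo, 0%R]) (m `]-oo, x[%classic) `^ (2^-1)%R < +oo)%E.
  by rewrite tail ltxx.
have [M AM] : exists M : R, (M%:E <= A_minus m)%E.
  by case: (A_minus m) Ay => [r _|_|//]; [exists r|exists 0; rewrite leey].
apply: (@integral_sqrt_lty _ `[Num.min 0 M, 0]) => //.
- by rewrite lebesgue_measure_itv/=; case: ifP => _; rewrite ltry.
- exact: measurable_lower_tail.
- by move=> x; rewrite measure_ge0 probability_le1.
move=> x /=; rewrite !in_itv/= => x0 /negP.
rewrite x0/= andbT ge_min negb_or -!ltNge => /andP[{}x0 Mx].
apply/eqP; rewrite eq_le measure_ge0 andbT leNgt; apply/negP => m0.
have : (A_minus m <= x%:E)%E.
  apply: ereal_inf_lbound; exists x => //; split => //.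
  by apply: lt_le_trans m0 _; apply: le_measure; rewrite ?inE//; apply: subset_itvl; rewrite bnd_simp.
by rewrite leNgt (lt_le_trans _ AM)// lte_fin.
Qed.

Lemma open_spanT : open_span (-oo : \bar R)%E +oo%E = setT.
Proof. by apply/seteqP; split => // x _; split; rewrite ?ltNyr ?ltry. Qed.

Lemma closed_spanT : closed_span (-oo : \bar R)%E +oo%E = setT.
Proof. by apply/seteqP; split => // x _; split; rewrite ?leNye ?leey. Qed.

End endpoints.

(** * Regularity of an admissible drift on the line *)

Section drift_regularity.
Context {R : realType}.
Notation leb := (@lebesgue_measure R).
Implicit Types b : R -> \bar R.

Lemma locally_bounded_fin_num b (x : R) : locally_bounded setT b ->
  b x \is a fin_num.
Proof.
move=> /(_ x I)[M] /nbhs_singleton/(_ I); case: (b x) => //=;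
  by rewrite leye_eq.
Qed.

Lemma locally_bounded_segment b (c d : R) : locally_bounded setT b ->
  exists M : R, forall x : R, x \in `[c, d] -> `|fine (b x)| <= M.
Proof.
move=> bb.
(* Compactness is used with the bounds M near +oo as the covering filter. *)
have /compact_near_coveringP := @segment_compact R c d.
move=> /(_ R +oo%R (fun M x => `|fine (b x)| <= M) _).
case => [x _|M0 [_ H]].
  have [M HM] := bb x I.
  exists ([set y | (setT y -> (`|b y| <= M%:E)%E)], [set M' | M <= M']) => /=.
    by split => //; apply: nbhs_pinfty_ge; exact: num_real.
  case=> y M' /= [/(_ I) yM MM']; rewrite -lee_fin.
  rewrite (_ : (`|fine (b y)|%:E = `|b y|)%E).
    by rewrite (le_trans yM)// lee_fin.
  by rewrite -[in RHS](fineK (locally_bounded_fin_num b y bb)).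
exists (M0 + 1) => x xcd.
by apply: H => //; rewrite ltrDl.
Qed.

Lemma fine_drift_continuous b (x : R) : locally_bounded setT b ->
  {for x, continuous b} -> {for x, continuous (fun y => fine (b y))}.
Proof.
move=> bb cb; apply: fine_cvg; rewrite fineK; first exact: cb.
exact: locally_bounded_fin_num.
Qed.

Lemma measurable_fun_finite (F : set R) (f : R -> R) :
  finite_set F -> measurable_fun F f.
Proof.
move=> finF mF Y mY; apply: countable_measurable => //.
by apply: finite_set_countable; apply: sub_finite_set finF; exact: subIsetl.
Qed.

(** On a segment the drift is bounded by compactness, and measurable because it is
    continuous off a finite set. *)
Lemma piecewise_locally_summable b : piecewise_continuous setT b ->
  locally_bounded setT b -> locally_summable b.
Proof.
move=> pcb bb c.
have [M HM] := locally_bounded_segment b (- c) c bb.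
apply: measurable_bounded_integrable => //.
- by rewrite /= lebesgue_measure_itv/=; case: ifP => _; rewrite ltry.
- have finF := pcb (- c) c (subsetT _).
  set F := [set x | _] in finF.
  have mF : measurable F by apply: countable_measurable => //; exact: finite_set_countable.
  rewrite (_ : [set` `[- c, c]] = (`[- c, c] `\` F) `|` F); last first.
    by rewrite setUC setDUK// => x [].
  apply/measurable_funU => //; first exact: measurableD.
  split; last exact: measurable_fun_finite.
  apply: subspace_continuous_measurable_fun; first exact: measurableD.
  apply: continuous_in_subspaceT => x; rewrite inE => -[xc nF].
  apply: fine_drift_continuous => //; apply: contrapT => nc.
  by apply: nF; split.
- by exists M; split; [exact: num_real|move=> N MN x xc /=; rewrite (le_trans (HM x xc))// ltW].
Qed.

End drift_regularity.

(** * Primitives of continuous functions *)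

Section primitive.
Context {R : realType}.
Notation leb := (@lebesgue_measure R).
Implicit Types h : R -> R.

Lemma is_derive_derive1 (f : R -> R) (x l : R) :
  derivable f x 1 -> derive1 f x = l -> is_derive x 1 f l.
Proof. by move=> df fl; apply: DeriveDef => //; rewrite -derive1E. Qed.

Definition primitive h (x : R) : R := drift_integral (EFin \o h) x.

Lemma primitive_derive h (x : R) : continuous h ->
  is_derive x 1 (primitive h) (h x).
Proof.
move=> ch.
have [||df f'] := drift_integral_derive (EFin \o h) x.
- exact: continuous_locally_summable.
- exact: ch.
exact: (is_derive_derive1 _ _ _ df f').
Qed.

Lemma primitive_continuous h : continuous h -> continuous (primitive h).
Proof.
by move=> ch; apply: drift_integral_continuous; exact: continuous_locally_summable.
Qed.

Lemma primitiveB h (x y : R) : continuous h -> x <= y ->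
  primitive h y - primitive h x = \int[leb]_(z in `[x, y]) h z.
Proof.
by move=> ch xy; rewrite /primitive drift_integralB//; exact: continuous_locally_summable.
Qed.

Lemma primitive_nondecreasing h : continuous h -> (forall x, 0 <= h x) ->
  {homo primitive h : x y / x <= y}.
Proof.
move=> ch h0 x y xy; rewrite -subr_ge0 primitiveB//.
exact: Rintegral_ge0.
Qed.

Lemma primitive_const h (x y : R) : continuous h -> x <= y ->
  (forall z, x <= z <= y -> h z = 0) -> primitive h y = primitive h x.
Proof.
move=> ch xy h0; apply/eqP; rewrite -subr_eq0 primitiveB//.
rewrite (@eq_Rintegral _ _ _ _ _ (cst 0)) ?Rintegral_cst ?mul0r//.
by move=> z; rewrite inE/= in_itv/= => /h0.
Qed.

Lemma primitive_gt h (x y : R) : continuous h -> x < y ->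
  (forall z, x < z < y -> 0 < h z) -> primitive h x < primitive h y.
Proof.
move=> ch xy h0; apply: (@gtr0_derive1_incr _ _ x y) => //.
- by move=> z _; have [] := primitive_derive h z ch.
- move=> z; rewrite in_itv/= => /h0; rewrite derive1E.
  by have /@derive_val-> := primitive_derive h z ch.
- by apply: continuous_subspaceT; exact: primitive_continuous.
Qed.

End primitive.

(** * Cutoffs adapted to the speed density *)

Section cutoff.
Context {R : realType}.
Variables (D : R) (b : R -> \bar R).
Hypothesis sb : locally_summable b.

Lemma speed_density_gt0 (x : R) : 0 < speed_density D b x.
Proof. exact: expR_gt0. Qed.

Lemma speed_density_continuous : continuous (speed_density D b).
Proof.
move=> x; apply: (@continuous_comp _ _ _ (fun x => 2 / D * drift_integral b x) (@expR R)).
  apply: cvgM; first exact: cvg_cst.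
  exact: drift_integral_continuous.
exact: continuous_expR.
Qed.

(** The reciprocal of the speed density is the density of the scale function: it
    solves the homogeneous equation D/2 u' + b u = 0. *)
Lemma speed_density_derive (x : R) : {for x, continuous (fun y => fine (b y))} ->
  is_derive x 1 (fun y => (speed_density D b y)^-1)
    (- (2 / D) * fine (b x) * (speed_density D b x)^-1).
Proof.
move=> cx; have [df f'] := drift_integral_derive b x sb cx.
have E : (fun y => (speed_density D b y)^-1) =
    expR \o ((- (2 / D)) *: (drift_integral b : R -> R^o)).
  by apply/funext => y /=; rewrite /speed_density -expRN -mulNr.
have d1 : is_derive x 1 (drift_integral b : R -> R^o) (fine (b x)).
  exact: (is_derive_derive1 _ _ _ df f').
rewrite E; apply: is_derive_eq.
rewrite /speed_density -expRN /= mulNr mulrC.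
by congr (_ * expR _); exact: mulNr.
Qed.

Definition bump (c x : R) : R := Num.max 0 ((x - c) * (c + 1 - x)).

Lemma bump_continuous c : continuous (bump c).
Proof.
move=> x; apply: (@continuous_max _ _ (cst 0) (fun x => (x - c) * (c + 1 - x))).
  exact: cvg_cst.
by apply: cvgM; apply: cvgB => //; exact: cvg_cst.
Qed.

Lemma bump_ge0 c x : 0 <= bump c x.
Proof. by rewrite le_max lexx. Qed.

Lemma bump_le1 c x : bump c x <= 1.
Proof. by rewrite ge_max ler01/=; have := sqr_ge0 (x - c - 2^-1); lra. Qed.

Lemma bump_eq0 c x : x <= c \/ c + 1 <= x -> bump c x = 0.
Proof.
case=> H; apply/max_idPl.
- by rewrite mulr_le0_ge0 ?subr_le0 ?subr_ge0// (le_trans H)// lerDl.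
- by rewrite mulr_ge0_le0 ?subr_le0 ?subr_ge0// (le_trans _ H)// lerDl.
Qed.

Lemma bump_gt0 c x : c < x < c + 1 -> 0 < bump c x.
Proof. by move=> /andP[cx xc]; rewrite lt_max mulr_gt0 ?orbT ?subr_gt0. Qed.

(** The weight cancels the factor 1/speed_density that the generator produces, so
    that the image of the test function below is continuous although b jumps. *)
Definition weighted_bump c x := bump c x * speed_density D b x.

Lemma weighted_bump_continuous c : continuous (weighted_bump c).
Proof.
move=> x; apply: cvgM; first exact: bump_continuous.
exact: speed_density_continuous.
Qed.

Lemma weighted_bump_ge0 c x : 0 <= weighted_bump c x.
Proof. by rewrite mulr_ge0 ?bump_ge0// ltW// speed_density_gt0. Qed.

Definition bump_mass c :=
  primitive (weighted_bump c) (c + 1) - primitive (weighted_bump c) c.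

Lemma bump_mass_gt0 c : 0 < bump_mass c.
Proof.
rewrite subr_gt0; apply: primitive_gt; [exact: weighted_bump_continuous| |].
  by rewrite ltrDl.
by move=> z zc; rewrite mulr_gt0 ?bump_gt0// speed_density_gt0.
Qed.

(** A C1 step that rises from 0 to 1 on [c, c + 1]. *)
Definition cutoff c x :=
  (primitive (weighted_bump c) x - primitive (weighted_bump c) c) / bump_mass c.

Lemma cutoff_nondecreasing c : {homo cutoff c : x y / x <= y}.
Proof.
move=> x y xy; rewrite ler_pM2r ?invr_gt0 ?bump_mass_gt0// lerB//.
apply: primitive_nondecreasing => //; first exact: weighted_bump_continuous.
exact: weighted_bump_ge0.
Qed.

Lemma cutoff0 c x : x <= c -> cutoff c x = 0.
Proof.
move=> xc; rewrite /cutoff (@primitive_const _ _ x c) ?subrr ?mul0r//.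
  exact: weighted_bump_continuous.
move=> z /andP[_ zc]; rewrite /weighted_bump bump_eq0 ?mul0r//.
by left.
Qed.

Lemma cutoff1 c x : c + 1 <= x -> cutoff c x = 1.
Proof.
move=> xc; rewrite /cutoff (@primitive_const _ _ (c + 1) x)//.
- by rewrite divff// gt_eqF// bump_mass_gt0.
- exact: weighted_bump_continuous.
move=> z /andP[cz _]; rewrite /weighted_bump bump_eq0 ?mul0r//.
by right.
Qed.

Lemma cutoff_derive (c x : R) :
  is_derive x 1 (cutoff c) (weighted_bump c x / bump_mass c).
Proof.
have d1 := @primitive_derive _ _ x (weighted_bump_continuous c).
have E : cutoff c = ((bump_mass c)^-1 *:
    ((primitive (weighted_bump c) : R -> R^o) - cst (primitive (weighted_bump c) c))).
  by apply/funext => y; rewrite /cutoff mulrC.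
rewrite E; apply: is_derive_eq.
by rewrite subr0 mulrC.
Qed.

Lemma cutoff_continuous c : continuous (cutoff c).
Proof.
move=> x; apply: differentiable_continuous; apply/derivable1_diffP.
by have [] := cutoff_derive c x.
Qed.

End cutoff.

(** * A bounded test function in the domain of the generator *)

Section test_function.
Context {R : realType}.
Variables (D : R) (b : R -> \bar R) (a : R).
Hypotheses (D0 : 0 < D) (sb : locally_summable b) (a0 : 0 <= a).

(** The scale density on [0, a], switched on over [-1, 0] and off over
    [a, a + 1]. *)
Definition test_slope x :=
  (speed_density D b x)^-1 * (cutoff D b (-1) x - cutoff D b a x).

Definition test_fun x := primitive test_slope x - primitive test_slope (-1).

(** The image of [test_fun] under the generator. Switching on gives the positive
    term, whose size does not depend on a; switching off gives the negative
    one. *)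
Definition test_image x :=
  D / 2 * (bump (-1) x / bump_mass D b (-1) - bump a x / bump_mass D b a).

Lemma speed_densityV_continuous : continuous (fun x => (speed_density D b x)^-1).
Proof.
move=> x; apply: cvgV; first by rewrite gt_eqF// speed_density_gt0.
exact: speed_density_continuous.
Qed.

Lemma test_slope_continuous : continuous test_slope.
Proof.
move=> x; apply: cvgM; first exact: speed_densityV_continuous.
by apply: cvgB; exact: cutoff_continuous.
Qed.

Lemma test_slope_ge0 x : 0 <= test_slope x.
Proof.
rewrite mulr_ge0 ?invr_ge0 ?(ltW (speed_density_gt0 D b x))// subr_ge0.
have [xa|/ltW ax] := leP x a.
- rewrite (cutoff0 D b sb a x xa) -(cutoff0 D b sb (-1) (Num.min x (-1))).
    by apply: cutoff_nondecreasing => //; rewrite ge_min lexx.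
  by rewrite ge_min lexx orbT.
- rewrite (cutoff1 D b sb (-1) x) ?addNr ?(le_trans a0)//.
  rewrite -(cutoff1 D b sb a (Num.max x (a + 1))).
    by apply: cutoff_nondecreasing => //; rewrite le_max lexx.
  by rewrite le_max lexx orbT.
Qed.

Lemma test_slope_left x : x <= -1 -> test_slope x = 0.
Proof.
move=> x1; rewrite /test_slope !cutoff0 ?subrr ?mulr0//.
by rewrite (le_trans x1)// (le_trans (lerN10 _)).
Qed.

Lemma test_slope_right x : a + 1 <= x -> test_slope x = 0.
Proof.
move=> x1; rewrite /test_slope !cutoff1 ?subrr ?mulr0//.
by rewrite addNr (le_trans _ x1)// addr_ge0.
Qed.

Lemma test_slope_middle x : 0 <= x <= a ->
  test_slope x = (speed_density D b x)^-1.
Proof.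
move=> /andP[x0 xa]; rewrite /test_slope (cutoff0 D b sb a x xa).
by rewrite cutoff1 ?addNr// subr0 mulr1.
Qed.

Lemma test_fun_nondecreasing : {homo test_fun : x y / x <= y}.
Proof.
move=> x y xy; rewrite lerB//; apply: primitive_nondecreasing => //.
  exact: test_slope_continuous.
exact: test_slope_ge0.
Qed.

Lemma test_fun_ge0 x : 0 <= test_fun x.
Proof.
have [x1|/ltW x1] := leP x (-1); last first.
  by rewrite -[0](subrr (primitive test_slope (-1))); exact: test_fun_nondecreasing.
rewrite /test_fun (@primitive_const _ test_slope x (-1)) ?subrr//.
  exact: test_slope_continuous.
by move=> z /andP[_]; exact: test_slope_left.
Qed.

Lemma test_fun_le x : test_fun x <= test_fun (a + 1).
Proof.
have [x1|/ltW x1] := leP x (a + 1); first exact: test_fun_nondecreasing.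
rewrite /test_fun (@primitive_const _ test_slope (a + 1) x)//.
  exact: test_slope_continuous.
by move=> z /andP[+ _]; exact: test_slope_right.
Qed.

Lemma test_fun_incr x : 0 <= x <= a -> test_fun x - test_fun 0 =
  \int[@lebesgue_measure R]_(y in `[0, x]) (speed_density D b y)^-1.
Proof.
move=> /andP[x0 xa].
rewrite /test_fun opprB addrA subrK primitiveB//; last exact: test_slope_continuous.
apply: eq_Rintegral => y; rewrite inE/= in_itv/= => /andP[y0 yx].
by rewrite test_slope_middle// y0 (le_trans yx).
Qed.

Lemma test_fun_derive (x : R) : is_derive x 1 test_fun (test_slope x).
Proof.
have d1 := @primitive_derive _ _ x test_slope_continuous.
have -> : test_fun = (primitive test_slope : R -> R^o) - cst (primitive test_slope (-1)).
  by apply/funext.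
by apply: is_derive_eq; rewrite subr0.
Qed.

Lemma derive1_test_fun : derive1 test_fun = test_slope.
Proof.
by apply/funext => x; rewrite derive1E; have /@derive_val-> := test_fun_derive x.
Qed.

Lemma test_fun_continuous : continuous test_fun.
Proof.
move=> x; apply: differentiable_continuous; apply/derivable1_diffP.
by have [] := test_fun_derive x.
Qed.

Lemma test_image_continuous : continuous test_image.
Proof.
move=> x; apply: cvgM; first exact: cvg_cst.
by apply: cvgB; (apply: cvgM; [exact: bump_continuous|exact: cvg_cst]).
Qed.

(** The bound is uniform in a: only the positive bump, located near -1, counts. *)
Lemma test_image_le x : test_image x <= D / 2 / bump_mass D b (-1).
Proof.
rewrite /test_image ler_pM2l ?divr_gt0// lerBlDr.
rewrite (@le_trans _ _ (1 / bump_mass D b (-1)))//.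
  by rewrite ler_pM2r ?bump_le1// invr_gt0 bump_mass_gt0.
by rewrite div1r lerDl divr_ge0 ?bump_ge0// ltW// bump_mass_gt0.
Qed.

Lemma test_image_ge x : - (D / 2 / bump_mass D b a) <= test_image x.
Proof.
rewrite /test_image -mulrN ler_pM2l ?divr_gt0// lerBrDl.
rewrite (@le_trans _ _ 0)//.
  rewrite subr_le0 -[leRHS]div1r ler_pM2r ?bump_le1// invr_gt0 bump_mass_gt0//.
by rewrite divr_ge0 ?bump_ge0// ltW// bump_mass_gt0.
Qed.

(** Product rule: the derivative of the scale density contributes the drift term,
    those of the cutoffs contribute the two bumps, freed of their weight. *)
Lemma test_slope_derive (x : R) : {for x, continuous (fun y => fine (b y))} ->
  is_derive x 1 test_slope
    (- (2 / D) * fine (b x) * test_slope x + 2 / D * test_image x).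
Proof.
move=> cx.
have d1 := @speed_density_derive _ D b sb x cx.
have d2 := @cutoff_derive _ D b sb (-1) x.
have d3 := @cutoff_derive _ D b sb a x.
have -> : test_slope = (fun y => (speed_density D b y)^-1) *
    (cutoff D b (-1) - cutoff D b a).
  by apply/funext.
apply: is_derive_eq.
have s0 : speed_density D b x != 0 by rewrite gt_eqF// speed_density_gt0.
have m1 : bump_mass D b (-1) != 0 by rewrite gt_eqF// bump_mass_gt0.
have ma : bump_mass D b a != 0 by rewrite gt_eqF// bump_mass_gt0.
rewrite /test_slope /test_image /weighted_bump /GRing.scale/= !fctE/=.
have D0' : D != 0 by rewrite gt_eqF.
by field; rewrite s0 m1 ma D0'.
Qed.

Lemma test_generator : locally_bounded setT b ->
  generator D b -oo%E +oo%E test_fun test_image.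
Proof.
move=> bb; split => //.
- exists (Num.max (test_fun (a + 1))
    (Num.max (D / 2 / bump_mass D b (-1)) (D / 2 / bump_mass D b a))) => x _.
  split.
    by rewrite ger0_norm ?test_fun_ge0// le_max test_fun_le.
  rewrite le_max; apply/orP; right; rewrite ler_norml; apply/andP; split.
    by rewrite lerNl le_max; apply/orP; right; rewrite lerNl test_image_ge.
  by rewrite le_max test_image_le.
- by apply: continuous_subspaceT; exact: test_fun_continuous.
- by apply: continuous_subspaceT; exact: test_image_continuous.
- by move=> x _; have [] := test_fun_derive x.
- by move=> x _; rewrite derive1_test_fun; exact: test_slope_continuous.
- move=> x _ cb; rewrite derive1_test_fun.
  have ds := test_slope_derive x (fine_drift_continuous b x bb cb).
  split; first by have [] := ds.
  rewrite derive1E; have /@derive_val-> := ds.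
  by field; rewrite gt_eqF.
Qed.

End test_function.

(** * Optional stopping along a time grid *)

Section integrable_real.
Context {d : measure_display} {Omega : measurableType d} {R : realType}.
Variable mu : {measure set Omega -> \bar R}.

Lemma integrable_EFinD (B : set Omega) (f g : Omega -> R) : measurable B ->
  mu.-integrable B (EFin \o f) -> mu.-integrable B (EFin \o g) ->
  mu.-integrable B (EFin \o (fun w => f w + g w)).
Proof.
move=> mB intf intg.
rewrite (_ : _ \o _ = (EFin \o f) \+ (EFin \o g))%E; first exact: integrableD.
by apply/funext.
Qed.

Lemma integrable_EFinB (B : set Omega) (f g : Omega -> R) : measurable B ->
  mu.-integrable B (EFin \o f) -> mu.-integrable B (EFin \o g) ->
  mu.-integrable B (EFin \o (fun w => f w - g w)).
Proof.
move=> mB intf intg.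
rewrite (_ : _ \o _ = (EFin \o f) \- (EFin \o g))%E; first exact: integrableB.
by apply/funext.
Qed.

End integrable_real.

Section stopping.
Context {R : realType}.
Context {d : measure_display} {Omega : measurableType d}.
Variable P : probability Omega R.
Implicit Types (X M : R -> Omega -> measurableTypeR R) (Y : nat -> Omega -> R).

Lemma bounded_integrable (B : set Omega) (h : Omega -> R) (N : R) :
  measurable B -> measurable_fun B h -> (forall w, `|h w| <= N) ->
  P.-integrable B (EFin \o h).
Proof.
move=> mB mh hN; apply: measurable_bounded_integrable => //.
  by rewrite (le_lt_trans (probability_le1 _ _))// ltry.
exists N; split; [exact: num_real|move=> r Nr w _ /=].
by rewrite (le_trans (hN w))// ltW.
Qed.

Lemma natural_filtration_preimage X (s t : R) (B : set (measurableTypeR R)) :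
  0 <= s -> s <= t -> measurable B -> natural_filtration X t (X s @^-1` B).
Proof.
move=> s0 st mB; apply: sub_sigma_algebra; exists s; first by rewrite /= in_itv/= s0.
by exists B => //; rewrite setTI.
Qed.

Lemma natural_filtrationI X (t : R) (A B : set Omega) :
  natural_filtration X t A -> natural_filtration X t B ->
  natural_filtration X t (A `&` B).
Proof.
set G := \bigcup_(s in `[0, t]) preimage_set_system setT (X s) measurable.
exact: (@measurableI _ (g_sigma_algebraType G)).
Qed.

Definition stays_below Y (c : R) (k : nat) : set Omega :=
  [set w | forall j, (j <= k)%N -> Y j w < c].

Lemma stays_below0 Y c : stays_below Y c 0 = [set w | Y 0%N w < c].
Proof.
apply/seteqP; split=> w /=; first exact.
by move=> H j; rewrite leqn0 => /eqP->.
Qed.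

Lemma stays_belowS Y c k :
  stays_below Y c k.+1 = stays_below Y c k `&` [set w | Y k.+1 w < c].
Proof.
apply/seteqP; split=> w /=.
  by move=> H; split=> [j jk|]; apply: H => //; rewrite leqW.
by case=> H1 H2 j; rewrite leq_eqVlt => /predU1P[->//|/H1].
Qed.

Lemma stays_below_nonincreasing Y c k n : (k <= n)%N ->
  stays_below Y c n `<=` stays_below Y c k.
Proof. by move=> kn w H j jk; apply: H; exact: leq_trans kn. Qed.

Lemma measurable_stays_below Y c k : (forall k, measurable_fun setT (Y k)) ->
  measurable (stays_below Y c k).
Proof.
move=> mY; have mj j : measurable [set w | Y j w < c].
  rewrite (_ : [set w | _] = setT `&` Y j @^-1` `]-oo, c[).
    exact: mY.
  by apply/seteqP; split=> w /=; rewrite in_itv/= => // -[].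
elim: k => [|k IH]; first by rewrite stays_below0.
by rewrite stays_belowS; exact: measurableI.
Qed.

Definition grid X (h : R) (j : nat) (w : Omega) : R := X (j%:R * h) w.

Lemma natural_filtration_stays_below X (h c : R) (k m : nat) : 0 <= h ->
  (k <= m)%N ->
  natural_filtration X (m%:R * h) (stays_below (grid X h) c k).
Proof.
move=> h0; have mj j : (j <= m)%N -> natural_filtration X (m%:R * h)
    [set w | (X (j%:R * h) w : R) < c].
  move=> jm; rewrite (_ : [set w | _] = X (j%:R * h) @^-1` `]-oo, c[%classic).
    apply: natural_filtration_preimage => //; first by rewrite mulr_ge0.
    by rewrite ler_wpM2r// ler_nat.
  by apply/seteqP; split=> w /=; rewrite in_itv.
elim: k => [|k IH] km; first by rewrite stays_below0; exact: mj.
rewrite stays_belowS; apply: natural_filtrationI; last exact: mj.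
by apply: IH; exact: ltnW.
Qed.

(** Path by path: the increments of f up to the first index at which y is at least
    c add up to at least f c - f (y 0) if there is such an index up to n, and to
    f (y n) - f (y 0) otherwise. The sequence u flags the indices at which the path
    has stayed below c so far. *)
Lemma telescope_until (f : R -> R) (c : R) (y : nat -> R) (u : nat -> bool) n :
  {homo f : x y / x <= y} ->
  u 0%N = (y 0%N < c) -> (forall k, u k.+1 = u k && (y k.+1 < c)) ->
  f c * (1 - (u n)%:R) + (u n)%:R * f (y n) - f (y 0%N) <=
  \sum_(k < n) (u k)%:R * (f (y k.+1) - f (y k)).
Proof.
move=> ndf u0 uS; elim: n => [|n IH].
  rewrite big_ord0 u0; case: ltP => yc /=.
    by rewrite subrr mulr0 add0r mul1r subrr.
  by rewrite subr0 mulr1 mul0r addr0 subr_le0 ndf.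
rewrite big_ord_recr /=; apply: le_trans (lerD IH (lexx _)).
rewrite uS; case: (u n) => /=.
  case: ltP => yc /=; first lra.
  by have := ndf _ _ yc; lra.
lra.
Qed.

(** Stopping on a grid of mesh h needs no stopping theorem in continuous time: the
    event of staying below c up to time k h belongs to the filtration at k h, so
    over it the martingale has a centered increment during the next step, and f
    increases on average by at most gam h. Summing over k gives on the right gam times the mean
    time spent on the grid before reaching c. *)
Lemma grid_stopping (f g : R -> R) (X : R -> Omega -> measurableTypeR R)
    (h c gam Mf Mg : R) (n : nat) :
  0 < h ->
  {homo f : x y / x <= y} -> (forall x, 0 <= f x <= Mf) -> continuous f ->
  continuous g -> (forall x, `|g x| <= Mg) -> (forall x, g x <= gam) ->
  (forall t, 0 <= t -> measurable_fun setT (X t)) ->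
  (forall w, {within `[0, +oo[, continuous (fun t : R => X t w : R)}) ->
  martingale P (natural_filtration X)
    (fun t w => f (X t w) - \int[@lebesgue_measure R]_(s in `[0, t]) g (X s w)) ->
  f c * (1 - fine (P (stays_below (grid X h) c n))) - \int[P]_w f (X 0 w) <=
  gam * (h * \sum_(k < n) fine (P (stays_below (grid X h) c k))).
Proof.
move=> h0 ndf f0M cf cg gM ggam mX cX hM.
set A := stays_below _ c.
have kh0 k : 0 <= k%:R * h by rewrite mulr_ge0// ltW.
have mA k : measurable (A k).
  by apply: measurable_stays_below => j; exact: mX.
have mf t : 0 <= t -> measurable_fun setT (fun w => f (X t w)).
  move=> t0; apply: (@measurableT_comp _ _ _ _ _ _ f); last exact: mX.
  exact: continuous_measurable_fun.
have intf t (B : set Omega) : measurable B -> 0 <= t -> P.-integrable B (EFin \o (fun w => f (X t w))).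
  move=> mB t0; apply: (bounded_integrable _ _ Mf) => [//||w].
    by apply: measurable_funTS; exact: mf.
  by have /andP[f0 fM] := f0M (X t w); rewrite ger0_norm.
have intg w s : 0 <= s -> (@lebesgue_measure R).-integrable `[0, s]
    (EFin \o (fun r => g (X r w))).
  move=> s0; apply: continuous_compact_integrable; first exact: segment_compact.
  have cgX : {within `[0, +oo[, continuous (fun r : R => g (X r w))}.
    move=> r; apply: continuous_comp; first exact: cX.
    exact: cg.
  apply: continuous_subspaceW cgX.
  by apply: subset_itvl; rewrite bnd_simp.
have timeint w s t : 0 <= s -> s <= t ->
    \int[@lebesgue_measure R]_(r in `[0, t]) g (X r w) -
    \int[@lebesgue_measure R]_(r in `[0, s]) g (X r w) <= gam * (t - s).
  move=> s0 st; rewrite Rintegral_itvB ?bnd_simp//; last exact: intg (le_trans s0 st).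
  have -> : gam * (t - s) = \int[@lebesgue_measure R]_(r in `]s, t]) gam.
    rewrite Rintegral_cst//= lebesgue_measure_itv/= lte_fin.
    case: ltP => [//|ts]; have -> : t = s by apply/eqP; rewrite eq_le st ts.
    by rewrite subrr.
  apply: le_Rintegral => //.
  - apply: integrableS (intg w t (le_trans s0 st)) => //.
    by apply: subset_itv; rewrite bnd_simp.
  - apply: measurable_bounded_integrable => //.
      by rewrite /= lebesgue_measure_itv/=; case: ifP => _; rewrite ltry.
    exists `|gam|; split; [exact: num_real|move=> N MN r _ /=].
    exact: ltW.
have step k : \int[P]_(w in A k) (f (X (k.+1%:R * h) w) - f (X (k%:R * h) w)) <=
    gam * (h * fine (P (A k))).
  pose M t w := f (X t w) - \int[@lebesgue_measure R]_(s in `[0, t]) g (X s w).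
  have kk1 : k%:R * h <= k.+1%:R * h by rewrite ler_wpM2r ?ler_nat// ltW.
  have intM t : 0 <= t -> P.-integrable (A k) (EFin \o M t).
    by move=> t0; apply: integrableS (mart_integrable hM t0).
  have M0 : \int[P]_(w in A k) (M (k.+1%:R * h) w - M (k%:R * h) w) = 0.
    rewrite RintegralB//; [|exact: intM|exact: intM].
    rewrite /Rintegral (mart_eq hM (kh0 k) kk1) ?subrr//.
    by apply: natural_filtration_stays_below => //; exact: ltW.
  have cstI : P.-integrable (A k) (EFin \o cst (gam * h)).
    exact: (bounded_integrable _ _ `|gam * h|).
  have -> : gam * (h * fine (P (A k))) =
      \int[P]_(w in A k) (M (k.+1%:R * h) w - M (k%:R * h) w + gam * h).
    rewrite RintegralD//; last first.
      by apply: integrable_EFinB => //; exact: intM.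
    by rewrite M0 add0r Rintegral_cst// mulrA.
  apply: le_Rintegral => //.
  - by apply: integrable_EFinB => //; exact: intf.
  - apply: integrable_EFinD => //.
    by apply: integrable_EFinB => //; exact: intM.
  move=> w _; have := timeint w _ _ (kh0 k) kk1.
  rewrite /M -mulrBl -natrB// subSnn mul1r.
  set I1 := \int[_]_(_ in _) _; set I0 := \int[_]_(_ in _) _; lra.
pose u k w : R := \1_(A k) w.
have uf k (v : Omega -> R) : \int[P]_(w in A k) v w = \int[P]_w (u k w * v w).
  rewrite Rintegral_mkcond; apply: eq_Rintegral => w _.
  by rewrite patch_indic /= mulrC.
have intu k (v : Omega -> R) : P.-integrable (A k) (EFin \o v) ->
    P.-integrable setT (EFin \o (fun w => u k w * v w)).
  move=> iv; rewrite (_ : _ \o _ = EFin \o (v \_ (A k))).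
    by rewrite -restrict_EFin; apply/integrable_restrict => //; rewrite setTI.
  by apply/funext => w /=; rewrite patch_indic /= mulrC.
pose v k w := f (X (k.+1%:R * h) w) - f (X (k%:R * h) w).
have intv k : P.-integrable setT (EFin \o (fun w => u k w * v k w)).
  by apply: intu; apply: integrable_EFinB => //; exact: intf.
have [intS ES] : P.-integrable setT (EFin \o (fun w => \sum_(k < n) u k w * v k w)) /\
    \int[P]_w (\sum_(k < n) u k w * v k w) = \sum_(k < n) \int[P]_w (u k w * v k w).
  elim: n => [|n [IH1 IH2]].
    rewrite (_ : (fun w => \sum_(k < 0) u k w * v k w) = cst 0); last first.
      by apply/funext => w; rewrite big_ord0.
    by rewrite big_ord0 Rintegral_cst// mul0r; split => //; exact: integrable0.
  rewrite (_ : (fun w => \sum_(k < n.+1) u k w * v k w) =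
      (fun w => \sum_(k < n) u k w * v k w + u n w * v n w)); last first.
    by apply/funext => w; rewrite big_ord_recr.
  by rewrite big_ord_recr/= -IH2 RintegralD//; split => //; exact: integrable_EFinD.
have cst1 (r : R) (B : set Omega) : measurable B -> P.-integrable B (EFin \o cst r).
  by move=> mB; exact: (bounded_integrable _ _ `|r|).
have Eu : \int[P]_w (u n w * f c) = f c * fine (P (A n)).
  by rewrite -(uf n (cst (f c))) Rintegral_cst.
have iu : P.-integrable setT (EFin \o (fun w => u n w * f c)) by apply: (intu n (cst (f c))); exact: cst1.
have -> : f c * (1 - fine (P (A n))) - \int[P]_w f (X 0 w) =
    \int[P]_w (f c - u n w * f c - f (X 0 w)).
  rewrite RintegralB//; [|by apply: integrable_EFinB => //; exact: cst1|exact: intf].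
  rewrite RintegralB//; last exact: cst1.
  have PT : fine (P [set: Omega]) = 1 by exact: (congr1 fine (probability_setT P)).
  by rewrite Eu Rintegral_cst// PT mulr1 mulrBr mulr1.
apply: (@le_trans _ _ (\int[P]_w (\sum_(k < n) u k w * v k w))).
  apply: le_Rintegral => //.
    apply: integrable_EFinB => //; last exact: intf.
    by apply: integrable_EFinB => //; exact: cst1.
  move=> w _.
  have inb (Q : Omega -> bool) : (w \in [set w | Q w]) = Q w.
    by apply/idP/idP; rewrite inE.
  have := @telescope_until f c (fun j => grid X h j w) (fun k => w \in A k) n ndf.
  rewrite /A stays_below0 inb => /(_ erefl) H.
  have {H} := H (fun k => _); rewrite /A.
  move=> /(_ ltac:(by move=> k; rewrite stays_belowS in_setI inb)).
  have -> : grid X h 0%N w = X 0 w by rewrite /grid mul0r.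
  rewrite -/A => H; apply: le_trans H.
  rewrite /u indicE; have /andP[fn _] := f0M (grid X h n w).
  by case: (w \in A n) => /=; lra.
rewrite ES mulr_sumr mulr_sumr; apply: ler_sum => k _.
by rewrite -uf; exact: step.
Qed.

End stopping.

(** * Time spent on the grid and the hitting time *)

Section integral_lower_bound.
Import HBNNSimple.
Context {d : measure_display} {T : measurableType d} {R : realType}.
Variable mu : {measure set T -> \bar R}.

(** The integral of a nonnegative function is a supremum over the simple functions
    below it, hence monotone for arbitrary functions. This spares the
    measurability of hitting times and of their means. *)
Lemma ge0_le_integral_nonmeasurable (f1 f2 : T -> \bar R) :
  (forall x, 0 <= f1 x)%E -> (forall x, f1 x <= f2 x)%E ->
  (\int[mu]_x f1 x <= \int[mu]_x f2 x)%E.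
Proof.
move=> f10 f12; have f20 x : (0 <= f2 x)%E by exact: le_trans (f10 x) (f12 x).
rewrite !ge0_integralTE//; apply: ereal_sup_le => _ [h /= hf1 <-].
by exists h => //= x; exact: le_trans (hf1 x) (f12 x).
Qed.

End integral_lower_bound.

Section liminf_bounds.
Context {R : realType}.
Implicit Types (u : nat -> \bar R) (x : \bar R).

Lemma limn_einf_ge u x : (\forall n \near \oo, x <= u n)%E -> (x <= limn_einf u)%E.
Proof.
move=> [N _ xu]; rewrite limn_einf_lim; apply: lime_ge; first exact: is_cvg_einfs.
exists N => // n /= Nn; apply: le_ereal_inf_tmp => _ [m /= nm <-].
by apply: xu; exact: leq_trans nm.
Qed.

Lemma limn_einf_le u x : (forall n, u n <= x)%E -> (limn_einf u <= x)%E.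
Proof.
move=> ux; rewrite limn_einf_lim; apply: lime_le; first exact: is_cvg_einfs.
apply: nearW => n; apply: le_trans (ux n).
by apply: ereal_inf_lbound; exists n => /=.
Qed.

End liminf_bounds.

Section occupation.
Context {R : realType}.
Context {d : measure_display} {Omega : measurableType d}.
Variable P : probability Omega R.
Variables (X : R -> Omega -> measurableTypeR R) (c : R).
Hypothesis mX : forall t : R, 0 <= t -> measurable_fun setT (X t).

(** The first time of the grid of mesh t / (n + 1) at which the path is at least c,
    capped at t, counted as the number of grid steps begun below c. *)
Definition occupation (t : R) (n : nat) (w : Omega) : R :=
  t / n.+1%:R *
  \sum_(k < n.+1) \1_(stays_below (grid X (t / n.+1%:R)) c k) w.

Lemma measurable_grid_stays t n k : 0 <= t ->
  measurable (stays_below (grid X (t / n.+1%:R)) c k).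
Proof.
by move=> t0; apply: measurable_stays_below => j; apply: mX;
  rewrite mulr_ge0// divr_ge0.
Qed.

Lemma measurable_occupation t n : 0 <= t -> measurable_fun setT (occupation t n).
Proof.
move=> t0; apply: measurable_funM => //; apply: measurable_sum => k.
exact/measurable_indic/measurable_grid_stays.
Qed.

Lemma occupation_ge0 t n w : 0 <= t -> 0 <= occupation t n w.
Proof. by move=> t0; rewrite mulr_ge0 ?divr_ge0// sumr_ge0. Qed.

Lemma occupation_le t n w : 0 <= t -> occupation t n w <= t.
Proof.
move=> t0; rewrite /occupation mulrAC ler_pdivrMr// ler_wpM2l//.
rewrite (@le_trans _ _ (\sum_(k < n.+1) 1))//; last by rewrite sumr_const card_ord.
by apply: ler_sum => k _; rewrite indicE; case: (_ \in _).
Qed.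

Lemma integral_occupation t n : 0 <= t ->
  (\int[P]_w (occupation t n w)%:E = (t / n.+1%:R *
    \sum_(k < n.+1) fine (P (stays_below (grid X (t / n.+1%:R)) c k)))%:E)%E.
Proof.
move=> t0; have mA := measurable_grid_stays t n ^~ t0.
have h0 : 0 <= t / n.+1%:R by rewrite divr_ge0.
rewrite /occupation; move: (t / n.+1%:R) h0 mA => h h0 mA.
under eq_integral do rewrite EFinM -sumEFin.
rewrite ge0_integralZl//=; last 2 first.
- apply: emeasurable_sum => k; exact/measurable_EFinP/measurable_indic.
- by move=> w _; apply: sume_ge0 => k _; rewrite lee_fin.
rewrite EFinM -sumEFin; congr (_ * _)%E.
rewrite ge0_integral_sum//=; last first.
  by move=> k; exact/measurable_EFinP/measurable_indic.
by apply: eq_bigr => k _; rewrite integral_indic// setIT fineK// fin_num_measure.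
Qed.

Lemma sum_lt_le (N j : nat) : \sum_(k < N) ((k < j)%N%:R : R) <= j%:R.
Proof.
rewrite -natr_sum ler_nat; elim: N j => [|N IH] j; first by rewrite big_ord0.
rewrite big_ord_recr /=; case: ltnP => Nj; last by rewrite addn0.
rewrite addn1; apply: leq_trans Nj; rewrite ltnS.
rewrite (@leq_trans (\sum_(k < N) 1))//; last by rewrite sum_nat_const card_ord muln1.
by apply: leq_sum => k _; exact: leq_b1.
Qed.

(** A path equal to a > c at time s stays above c for a short while after s by
    continuity, and a fine grid has a point in that short interval. Asking for
    c < a is what lets the grid see a single visit to a. *)
Lemma occupation_hit t s e a w : 0 < t -> 0 <= s -> 0 < e -> c < a ->
  {within `[0, +oo[, continuous (fun t : R => X t w : R)} -> X s w = a ->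
  \forall n \near \oo, occupation t n w <= s + e.
Proof.
move=> t0 s0 e0 ca cX Xs.
have : \forall r \near within `[0, +oo[ (nbhs s), c < (X r w : R).
  apply: cvgr_gt; last exact: ca.
  rewrite -Xs; move/subspace_continuousP : cX; apply.
  by rewrite /= in_itv/= s0.
rewrite /within /= => /nbhs_ballP[dl /= dl0 Hdl].
pose e' := Num.min e dl; have e'0 : 0 < e' by rewrite lt_min e0.
near=> n; pose h := t / n.+1%:R.
have h0 : 0 < h by rewrite divr_gt0.
have he : h < e'.
  rewrite /h ltr_pdivrMr// -ltr_pdivrMl// mulrC.
  rewrite (@lt_le_trans _ _ n%:R)//; last by rewrite ler_nat.
  by near: n; exact: nbhs_infty_gtr.
(* The first grid index strictly after time s. *)
pose j := (Num.truncn (s / h)).+1.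
have /andP[j1 j2] : (Num.truncn (s / h))%:R <= s / h < j%:R.
  by apply: truncn_itv; rewrite divr_ge0// ltW.
have js : s < j%:R * h by rewrite -ltr_pdivrMr.
have jse : j%:R * h <= s + h.
  by rewrite /j -natr1 mulrDl mul1r lerD2r -ler_pdivlMr.
have Xj : c < (X (j%:R * h) w : R).
  apply: Hdl; last by rewrite /= in_itv/= andbT mulr_ge0// ltW.
  rewrite /ball/= ltr0_norm ?subr_lt0// opprB ltrBlDl.
  rewrite (le_lt_trans jse)// ltrD2l (lt_le_trans he)// ge_min lexx orbT//.
rewrite /occupation -/h (@le_trans _ _ (h * j%:R))//; last first.
  by rewrite mulrC (le_trans jse)// lerD2l (le_trans (ltW he))// ge_min lexx.
rewrite ler_pM2l//; apply: le_trans (sum_lt_le n.+1 j).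
apply: ler_sum => k _; rewrite indicE ler_nat; case: (ltnP k j) => kj.
  exact: leq_b1.
rewrite memNset// => /(_ j kj); rewrite /grid.
by rewrite ltNge (ltW Xj).
Unshelve. all: by end_near. Qed.

End occupation.

(** * From a test function to a lower bound on mean hitting times *)

Section hitting.
Context {R : realType}.
Context {d : measure_display} {Omega : measurableType d}.
Variable P : probability Omega R.
Variables (X : R -> Omega -> measurableTypeR R) (f g : R -> R).
Variables (x0 a gam Mf Mg : R).
Hypothesis mX : forall t : R, 0 <= t -> measurable_fun setT (X t).
Hypothesis cX : forall w, {within `[0, +oo[, continuous (fun t : R => X t w : R)}.
Hypothesis startX : {ae P, forall w, X 0 w = x0}.
Hypothesis martX : martingale P (natural_filtration X)
  (fun t w => f (X t w) - \int[@lebesgue_measure R]_(s in `[0, t]) g (X s w)).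
Hypothesis ndf : {homo f : x y / x <= y}.
Hypothesis f0M : forall x, 0 <= f x <= Mf.
Hypothesis cf : continuous f.
Hypothesis cg : continuous g.
Hypothesis gM : forall x, `|g x| <= Mg.
Hypothesis ggam : forall x, g x <= gam.
Hypothesis gam0 : 0 < gam.

Lemma integral_start : \int[P]_w f (X 0 w) = f x0.
Proof.
have PT : fine (P [set: Omega]) = 1 by exact: (congr1 fine (probability_setT P)).
rewrite -[RHS]mulr1 -PT -Rintegral_cst//; congr fine.
have mf : measurable_fun setT f by exact: continuous_measurable_fun.
apply: ae_eq_integral => //.
  apply/measurable_EFinP; apply: (@measurableT_comp _ _ _ _ _ _ f) => //.
  exact: mX.
by apply: filterS startX => w /= ->.
Qed.

(** Staying below c throughout [0, t] costs a grid time t, so by Markov's inequality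
    the unstopped event is absorbed by the term f c / t. *)
Lemma occupation_lower_bound (t c : R) n : 0 < t ->
  (((f c - f x0) / (gam + f c / t))%:E <= \int[P]_w (occupation X c t n w)%:E)%E.
Proof.
move=> t0; have t0' := ltW t0; rewrite integral_occupation// lee_fin.
set h := t / _; have h0 : 0 < h by rewrite divr_gt0.
have := @grid_stopping _ _ _ P f g X h c gam Mf Mg n.+1 h0 ndf f0M cf cg gM ggam mX cX martX.
rewrite integral_start; set A := stays_below _ c; set S := h * _ => key.
have /andP[fc0 _] := f0M c.
have mA k : measurable (A k) by exact: measurable_grid_stays.
rewrite ler_pdivrMr; last by rewrite ltr_wpDr// divr_ge0.
suff tA : t * fine (P (A n.+1)) <= S.
  have -> : S * (gam + f c / t) = gam * S + f c * (S / t) by rewrite mulrDr mulrC mulrA [S * _]mulrC mulrA.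
  have : fine (P (A n.+1)) <= S / t by rewrite ler_pdivlMr// mulrC.
  by move=> /(ler_wpM2l fc0); lra.
have -> : t = h * n.+1%:R by rewrite /h divfK.
rewrite /S -mulrA ler_pM2l//.
have -> : n.+1%:R * fine (P (A n.+1)) = \sum_(k < n.+1) fine (P (A n.+1)).
  by rewrite sumr_const card_ord mulr_natl.
apply: ler_sum => k _; apply: fine_le; rewrite ?fin_num_measure//.
by apply: le_measure; rewrite ?inE//; apply: stays_below_nonincreasing; exact: ltnW.
Qed.

(** The grid times are at most the hitting time plus a vanishing error and are
    bounded by t, so their upper limit has mean at least the bound, by Fatou's
    lemma applied to t minus the grid times. *)
Lemma mean_hitting_time_ge_grid (t c : R) : 0 < t -> c < a ->
  (((f c - f x0) / (gam + f c / t))%:E <= mean_hitting_time P X a)%E.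
Proof.
move=> t0 ca; have t0' := ltW t0; set K := _ / _.
pose H n w := occupation X c t n w.
pose L w := limn_einf (fun n => (t - H n w)%:E).
have mtH n : measurable_fun setT (fun w => (t - H n w)%:E).
  by apply/measurable_EFinP; apply: measurable_funB => //; exact: measurable_occupation.
have tH0 n w : (0 <= (t - H n w)%:E)%E by rewrite lee_fin subr_ge0 occupation_le.
have L0 w : (0 <= L w)%E by apply: limn_einf_ge; exact: nearW.
have Lt w : (L w <= t%:E)%E.
  by apply: limn_einf_le => n; rewrite lee_fin lerBlDr lerDl occupation_ge0.
have Lfin w : L w \is a fin_num by rewrite ge0_fin_numE// (le_lt_trans (Lt w))// ltry.
have tL0 w : (0 <= t%:E - L w)%E by rewrite sube_ge0; [exact: Lt|rewrite Lfin].
have mL : measurable_fun setT L.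
  rewrite /L /limn_einf; apply: measurableT_comp => //.
  apply: (measurable_fun_limn_esup (f := fun n w => (- (t - H n w)%:E)%E)) => n.
  exact: measurableT_comp.
have L_hit w s : 0 <= s -> (X s w : R) = a -> (t%:E - L w <= s%:E)%E.
  move=> s0 Xs; rewrite -(fineK (Lfin w)) -EFinB lee_fin.
  apply/ler_addgt0Pr => e e0; rewrite lerBlDr -lerBlDl -lee_fin fineK//.
  apply: limn_einf_ge.
  apply: filterS (occupation_hit X c t s e a w t0 s0 e0 ca (cX w) Xs) => n.
  by rewrite lee_fin /H; lra.
apply: (@le_trans _ _ (\int[P]_w (t%:E - L w)))%E; last first.
  apply: ge0_le_integral_nonmeasurable => w; first exact: tL0.
  by apply: le_ereal_inf_tmp => _ [s /= [s0 Xs] <-]; exact: L_hit.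
have intL : (\int[P]_w L w <= (t - K)%:E)%E.
  apply: le_trans; first exact: fatou.
  apply: limn_einf_le => n.
  have := occupation_lower_bound t c n t0; rewrite -/K.
  have -> : (\int[P]_w (t - H n w)%:E = t%:E - \int[P]_w (H n w)%:E)%E.
    under eq_integral do rewrite EFinB.
    rewrite integralB//=.
    - by rewrite integral_cst//= probability_setT mule1.
    - by apply: (bounded_integrable P _ (cst t) t) => // w; rewrite ger0_norm.
    - apply: (bounded_integrable P _ (H n) t) => [//||w]; first exact: measurable_occupation.
      by rewrite ger0_norm ?occupation_ge0 ?occupation_le.
  rewrite integral_occupation// -EFinB !lee_fin => KS; rewrite lerD2l lerN2//.
have : (\int[P]_w L w + \int[P]_w (t%:E - L w) = t%:E)%E.
  rewrite -ge0_integralD//.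
  - under eq_integral do rewrite addeC subeK//.
    by rewrite integral_cst//= probability_setT mule1.
  - by apply: emeasurable_funB.
have L0i : (0 <= \int[P]_w L w)%E by exact: integral_ge0.
have : (0 <= \int[P]_w (t%:E - L w))%E by apply: integral_ge0.
move: intL L0i; case: (\int[P]_w L w)%E => [l| |] //.
case: (\int[P]_w (t%:E - L w))%E => [r| |] //=.
rewrite !lee_fin => lK l0 r0 [lrt]; lra.
Qed.

Lemma mean_hitting_time_ge0 b : (0 <= mean_hitting_time P X b)%E.
Proof.
apply: integral_ge0 => w _; apply: le_ereal_inf_tmp => _ [s /= [s0 _] <-].
by rewrite lee_fin.
Qed.

(** First the horizon t tends to +oo, then the level c increases to a. *)
Lemma mean_hitting_time_ge :
  (((f a - f x0) / gam)%:E <= mean_hitting_time P X a)%E.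
Proof.
have := mean_hitting_time_ge0 a; have := mean_hitting_time_ge_grid.
case: (mean_hitting_time P X a) => [m H m0|_ _|//]; last by rewrite leey.
rewrite lee_fin in m0.
have Hc c : c < a -> f c - f x0 <= m * gam.
  move=> ca; apply/ler_addgt0Pr => e e0.
  have /andP[fc0 _] := f0M c.
  have t0 : 0 < m * f c / e + 1 by rewrite ltr_wpDl// divr_ge0 ?mulr_ge0// ltW.
  have := H _ c t0 ca; rewrite lee_fin ler_pdivrMr; last first.
    by rewrite ltr_wpDr// divr_ge0// ltW.
  move=> /le_trans; apply; rewrite mulrDr lerD2l mulrA ler_pdivrMr//.
  by rewrite mulrDr mulr1 [e * _]mulrC divfK ?gt_eqF// lerDl ltW.
rewrite lee_fin ler_pdivrMr// lerBlDr leNgt; apply/negP => fa.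
have cfa : f c @[c --> a^'-] --> f a by apply: cvg_at_left_filter; exact: cf.
have near_a : \forall c \near a^'-, m * gam + f x0 < f c.
  exact: (cvgr_gt _ cfa).
have [c [ca fc]] := filter_ex (filterI (nbhs_left_lt a) near_a).
by have := Hc c ca; lra.
Qed.

End hitting.

(** * Averaging the scale function over the target law *)

Section tail_integral.
Context {R : realType}.
Notation leb := (@lebesgue_measure R).
Variables (mu : probability (measurableTypeR R) R) (e : R -> R).
Hypothesis ce : continuous e.
Hypothesis e0 : forall x, 0 < e x.

Let kernel (z : R * R) : \bar R :=
  ((e z.2)^-1 * \1_(`[0, +oo[%classic) z.2 * \1_([set z : R * R | z.2 < z.1]) z)%:E.

Let kernel_ge0 z : (0 <= kernel z)%E.
Proof. by rewrite lee_fin !mulr_ge0// invr_ge0 ltW. Qed.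

Let einv_continuous : continuous (fun x => (e x)^-1).
Proof. by move=> x; apply: cvgV; [rewrite gt_eqF|exact: ce]. Qed.

Let measurable_kernel : measurable_fun setT kernel.
Proof.
apply/measurable_EFinP; apply: measurable_funM.
  apply: measurable_funM.
    apply: (@measurableT_comp _ _ _ _ _ _ (fun x => (e x)^-1) _ snd) => //.
    exact: continuous_measurable_fun.
  exact: measurableT_comp.
apply: measurable_indic.
rewrite (_ : [set z : R * R | _] = setT `&` (fun z : R * R => z.1 - z.2) @^-1` `]0, +oo[%classic).
  have : measurable_fun setT (fun z : R * R => z.1 - z.2) by exact: measurable_funB.
  by apply.
by apply/seteqP; split => z /=; rewrite in_itv/= andbT subr_gt0 => // -[].
Qed.

(** The scale function of the diffusion when e is its speed density. *)
Definition scale (a : R) : \bar R := (\int[leb]_(x in `[0%R, a]) ((e x)^-1)%:E)%E.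

Lemma scale_kernel a : (\int[leb]_x kernel (a, x) = scale a)%E.
Proof.
rewrite /scale -[RHS]integral_itv_bndo_bndc; last first.
  apply/measurable_EFinP; apply: measurable_funTS; exact: continuous_measurable_fun.
rewrite [RHS]integral_mkcond; apply: eq_integral => x _.
rewrite patchE /kernel/= !indicE.
have -> : ((a, x) \in [set z : R * R | z.2 < z.1]) = (x < a).
  by apply/idP/idP; rewrite inE.
rewrite !mem_setE !in_itv/= andbT.
by case: (0 <= x); case: (x < a); rewrite ?mulr1 ?mulr0.
Qed.

Lemma measurable_scale : measurable_fun setT scale.
Proof.
rewrite (_ : scale = fun a => \int[leb]_x kernel (a, x))%E.
  exact: measurable_fun_fubini_tonelli_F.
by apply/funext => a; rewrite scale_kernel.
Qed.

(** Tonelli: x lies below a for a set of targets a of mass mu(]x, +oo[). *)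
Lemma integral_scale :
  (\int[mu]_a scale a = \int[leb]_(x in `[0%R, +oo[) ((e x)^-1%:E * mu `]x, +oo[%classic))%E.
Proof.
have -> : (\int[mu]_a scale a = \int[mu]_a \int[leb]_x kernel (a, x))%E.
  by apply: eq_integral => a _; rewrite scale_kernel.
rewrite (fubini_tonelli (m1 := mu) (m2 := leb) kernel)//.
rewrite [RHS]integral_mkcond; apply: eq_integral => x _.
rewrite patchE /kernel/= indicE mem_setE in_itv/= andbT.
case: ifP => x0; last first.
  by under eq_integral do rewrite mulr0 mul0r; rewrite integral0.
have E (a : R) : \1_([set z : R * R | z.2 < z.1]) (a, x) = \1_(`]x, +oo[%classic) a :> R.
  rewrite !indicE; congr ((_ : bool)%:R).
  by apply/idP/idP; rewrite !inE/= in_itv/= andbT.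
under eq_integral do rewrite mulr1 E EFinM.
rewrite ge0_integralZl//=.
- by rewrite integral_indic// setIT.
- exact/measurable_EFinP/measurable_indic.
- by rewrite lee_fin invr_ge0 ltW.
Qed.

(** With y the tail at x, sqrt y <= e x + y / e x. Since e is integrable, an infinite
    integral of sqrt y forces an infinite integral of y / e. *)
Lemma integral_scale_pinfty (m : probability (measurableTypeR R) R) (p : R) :
  0 < p -> (forall x : R, (p%:E * m `]x, +oo[%classic <= mu `]x, +oo[%classic)%E) ->
  (\int[leb]_(x in `[0%R, +oo[) (e x)%:E < +oo)%E ->
  (\int[leb]_(x in `[0%R, +oo[) (m `]x, +oo[%classic) `^ (2^-1)%R = +oo)%E ->
  (\int[mu]_a scale a = +oo)%E.
Proof.
move=> p0 pm Efin tailm; rewrite integral_scale.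
have mEFin (h : R -> R) : continuous h -> measurable_fun (`[0, +oo[%classic : set R) (EFin \o h).
  move=> ch; apply/measurable_EFinP; apply: measurable_funTS.
  exact: continuous_measurable_fun.
have mtail (n : probability (measurableTypeR R) R) :
    measurable_fun (`[0, +oo[%classic : set R) ((fun x => n `]x, +oo[%classic) : R -> \bar R).
  by apply: measurable_funS (measurable_upper_tail n).
have mJ : measurable_fun (`[0, +oo[%classic : set R)
    ((fun x => (e x)^-1%:E * mu `]x, +oo[%classic)%E : R -> \bar R).
  by apply: emeasurable_funM => //; exact: mEFin einv_continuous.
have mpJ : measurable_fun (`[0, +oo[%classic : set R)
    ((fun x => p^-1%:E * ((e x)^-1%:E * mu `]x, +oo[%classic))%E : R -> \bar R).
  exact: (emeasurable_funM (measurable_cst _) mJ).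
have J0 x : (0 <= (e x)^-1%:E * mu `]x, +oo[%classic)%E.
  by rewrite mule_ge0// lee_fin invr_ge0 ltW.
apply/eqP; rewrite eq_le leey/= leNgt; apply/negP => Jfin.
suff : (\int[leb]_(x in `[0%R, +oo[) (m `]x, +oo[%classic) `^ (2^-1)%R < +oo)%E.
  by rewrite tailm ltxx.
apply: (@le_lt_trans _ _ (\int[leb]_(x in `[0%R, +oo[)
    ((e x)%:E + p^-1%:E * ((e x)^-1%:E * mu `]x, +oo[%classic)))%E).
  apply: ge0_le_integral => //.
  - by move=> x _; exact: poweR_ge0.
  - exact: (measurableT_comp (measurable_poweR _) (mtail m)).
  - exact: (emeasurable_funD (mEFin _ ce) mpJ).
  move=> x _; rewrite poweR12_sqrt//.
  apply: (@le_trans _ _ ((e x)%:E + (e x)^-1%:E * m `]x, +oo[%classic)%E); last first.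
    rewrite leeD2l// muleCA lee_pmul2l ?lte_fin ?invr_gt0//.
    by rewrite lee_pdivlMl.
  have : m `]x, +oo[%classic \is a fin_num by rewrite fin_num_measure.
  have : (0 <= m `]x, +oo[%classic)%E by [].
  case: (m `]x, +oo[%classic) => //= r; rewrite !lee_fin => r0 _.
  rewrite -[in leRHS](sqr_sqrtr r0) mulrC.
  have s0 := sqrtr_ge0 r; have ex0 := e0 x.
  rewrite -(ler_pM2r ex0) mulrDl divfK ?gt_eqF//.
  by set s := Num.sqrt r; nra.
rewrite ge0_integralD//=.
- rewrite ge0_integralZl//=; last by rewrite lee_fin invr_ge0 ltW.
  by rewrite lte_add_pinfty// lte_mul_pinfty// lee_fin invr_ge0 ltW.
- by move=> x _; rewrite lee_fin ltW.
- exact: mEFin.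
- by move=> x _; rewrite mule_ge0// lee_fin invr_ge0 ltW.
Qed.

End tail_integral.

(** * The mean hitting time of a random target *)

Theorem theorem1 (R : realType) (D p : R)
    (mum mup mu : probability (measurableTypeR R) R)
    (hD : 0 < D) (hp : 0 < p < 1)
    (hmum : mum `]-oo, 0[%classic = 1%E)
    (hmup : mup `]0, +oo[%classic = 1%E)
    (hmu : forall A : set (measurableTypeR R), measurable A ->
      (mu A = (1 - p)%:E * mum A + p%:E * mup A)%E)
    (tailm : (\int[@lebesgue_measure R]_(x in `]-oo, 0%R])
                (mum `]-oo, x[%classic) `^ (2^-1)%R = +oo)%E)
    (tailp : (\int[@lebesgue_measure R]_(x in `[0%R, +oo[)
                (mup `]x, +oo[%classic) `^ (2^-1)%R = +oo)%E)
    (b : R -> \bar R) (hb : admissible D mu mum mup b)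
    (d : measure_display) (Omega : measurableType d)
    (P : probability Omega R) (X : R -> Omega -> measurableTypeR R)
    (hX : diffusion P D b (A_minus mum) (A_plus mup) 0 X) :
  (\int[mu]_a mean_hitting_time P X a = +oo)%E.

Proof.
have Am := A_minus_ninfty mum tailm; have Ap := A_plus_pinfty mup tailp.
rewrite {}Am {}Ap in hX.
have [pcb bb finE] : [/\ piecewise_continuous setT b, locally_bounded setT b &
    (\int[@lebesgue_measure R]_x (speed_density D b x)%:E < +oo)%E].
  have spanE : open_span (A_minus mum) (A_plus mup) = setT.
    by rewrite A_minus_ninfty// A_plus_pinfty// open_spanT.
  by case: hb; rewrite spanE.
have sb := piecewise_locally_summable b pcb bb.
pose e := speed_density D b.
have ce : continuous e by exact: speed_density_continuous.
have e0 x : 0 < e x by exact: speed_density_gt0.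
pose gam := D / 2 / bump_mass D b (-1).
have gam0 : 0 < gam by rewrite !divr_gt0 ?bump_mass_gt0.
(* The constant in front of the scale function does not depend on the target. *)
have mean_ge a : (gam^-1%:E * scale e a <= mean_hitting_time P X a)%E.
  have [a0|a0] := leP 0 a; last first.
    rewrite /scale set_itv_ge ?bnd_simp -?ltNge// integral_set0 mule0.
    exact: mean_hitting_time_ge0.
  pose f := test_fun D b a.
  have fE : (scale e a = (f a - f 0)%:E)%E.
    rewrite /f test_fun_incr ?a0 ?lexx// fineK//.
    apply: integrable_fin_num => //.
    apply: continuous_compact_integrable; first exact: segment_compact.
    by apply: continuous_subspaceT; exact: speed_densityV_continuous.
  have genf := test_generator D b a hD sb a0 bb.
  have [[M HM] _ _ _ _ _ _ _] := genf.
  rewrite fE -EFinM mulrC.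
  have fM x : 0 <= f x <= M.
    rewrite /f test_fun_ge0//=; have [] := HM x; first by rewrite closed_spanT.
    by move=> + _; exact/le_trans/ler_norm.
  have gM x : `|test_image D b a x| <= M.
    by have [] := HM x; first by rewrite closed_spanT.
  have ggam x : test_image D b a x <= gam by exact: test_image_le.
  have ndf : {homo f : x y / x <= y} by exact: test_fun_nondecreasing.
  have cf : continuous f by exact: test_fun_continuous.
  have cg : continuous (test_image D b a) by exact: test_image_continuous.
  exact: (mean_hitting_time_ge P X f (test_image D b a) 0 a gam M M
    (diff_meas hX) (diff_cont hX) (diff_start hX) (diff_mart hX genf)
    ndf fM cf cg gM ggam gam0).
have scale0 a : (0 <= scale e a)%E.
  by apply: integral_ge0 => x _; rewrite lee_fin invr_ge0 ltW.
have scaley : (\int[mu]_a scale e a = +oo)%E.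
  have /andP[p0 p1] := hp.
  apply: (integral_scale_pinfty mu e ce e0 mup p) => //.
  - move=> x; rewrite hmu// leeDr// mule_ge0// lee_fin subr_ge0 ltW//.
  - apply: le_lt_trans finE; apply: ge0_subset_integral => //.
    + by apply/measurable_EFinP; exact: continuous_measurable_fun.
    + by move=> x _; rewrite lee_fin ltW// e0.
apply/eqP; rewrite -leye_eq.
apply: (@le_trans _ _ (\int[mu]_a (gam^-1%:E * scale e a))%E); last first.
  apply: ge0_le_integral_nonmeasurable => a; last exact: mean_ge.
  by rewrite mule_ge0// lee_fin invr_ge0 ltW.
rewrite ge0_integralZl//; last 2 first.
- exact: measurable_scale.
- by rewrite lee_fin invr_ge0 ltW.
by rewrite scaley gt0_muley// lte_fin invr_gt0.
Qed.
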